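(* Let $n,m\in\mathbb{N}$ and let $A_k\in\mathbb{R}^{n\times n}$, $B_k\in\mathbb{R}^{n\times m}$, $Q_k\in\mathbb{S}^n_+$, $R_k\in\mathbb{S}^m_{++}$ ($k\in\mathbb{N}_0$) be problem data such that: $\|A_k\|_2,\|B_k\|_2,\|Q_k\|_2,\|R_k\|_2$ are bounded uniformly in $k$; every $A_k$ is non-singular; there is $d\in\mathbb{N}$ such that for all $k\in\mathbb{N}_0$ the $d$-step controllability matrix $\mathcal{C}_{k,d}$ has full row rank and the $d$-step observability matrix $\mathcal{O}_{k,d}$ has full column rank; and, for the lifted data $(\tilde A_t,\tilde B_t,\tilde Q_t,\tilde R_t)_{t\in\mathbb{N}_0}$ constructed with this $d$, $\inf_{t}\lambda_{\min}(\tilde Q_t)>0$, $\inf_{t}\lambda_{\min}(\tilde B_t\tilde B_t')>0$, and $\inf_{t}\lambda_{\min}(\tilde A_t\tilde A_t')>0$. Let $(\hat X_{t+1})_{t\in\mathbb{N}_0}\subset\mathbb{S}^n_{++}$ be a bounded sequence with $\hat X_t\succeq\mathcal{R}_t(\hat X_{t+1})$ for all $t\in\mathbb{N}$, where $\mathcal{R}_t$ is the Riccati operator of the lifted data. Put $$K_t:=(\tilde R_t+\tilde B_t'\hat X_{t+1}\tilde B_t)^{-1}\tilde B_t'\hat X_{t+1}\tilde A_t,\qquad t\in\mathbb{N}_0,$$ $$\overline\omega:=\sup_{t\in\mathbb{N}_0}\|\mathcal{R}_t(\hat X_{t+1})\|_2,\qquad \underline\omega:=\inf_{t\in\mathbb{N}_0}\lambda_{\min}(\mathcal{R}_t(\hat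 X_{t+1})),\qquad \underline\lambda:=\inf_{t\in\mathbb{N}_0}\lambda_{\min}(\tilde Q_t+K_t'\tilde R_tK_t).$$ Then $\overline\omega<+\infty$, $\underline\omega>0$, $0<\underline\lambda\le\overline\omega$, and every trajectory of $\tilde x_{t+1}=\tilde A_t\tilde x_t+\tilde B_t\tilde u_t$ ($t\in\mathbb{N}_0$) under the policy $\tilde u_t=-K_t\tilde x_t$ satisfies $$|\tilde x_t|^2\le\frac{\overline\omega}{\underline\omega}\Big(1-\frac{\underline\lambda}{\overline\omega}\Big)^t|\tilde x_0|^2\quad\text{for all } t\in\mathbb{N}_0.$$
   Context: Notation: $\mathbb{N}_0=\mathbb{N}\cup\{0\}$; $M'$ is the transpose; $|\cdot|$ is the Euclidean norm, $\|\cdot\|_2$ the induced (spectral) norm; $\mathbb{S}^n,\mathbb{S}^n_+,\mathbb{S}^n_{++}$ are the real symmetric, positive semi-definite, positive definite $n\times n$ matrices; $\preceq,\succeq$ is the Loewner order; $\lambda_{\min}$ is the smallest eigenvalue. Controllability and observability matrices: $\Theta_{k,d}:=A_{k+d-1}A_{k+d-2}\cdots A_k$, $\Theta_{k,0}:=I_n$, $C_k:=Q_k^{1/2}$, $\mathcal{C}_{k,d}:=[\,\Theta_{k+1,d-1}B_k\;\;\Theta_{k+2,d-2}B_{k+1}\;\cdots\;\Theta_{k+d,0}B_{k+d-1}\,]$, and $\mathcal{O}_{k,d}$ is the vertical stack of $C_k\Theta_{k,0},\,C_{k+1}\Theta_{k,1},\dots,C_{k+d}\Theta_{k,d}$. Lifted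 data: for $t\in\mathbb{N}_0$, $\hat A_t:=I_{n(d+1)}-\begin{bmatrix}0_{n,nd}&0_{n,n}\\ \mathrm{diag}(A_{dt},\dots,A_{d(t+1)-1})&0_{nd,n}\end{bmatrix}$, $\hat B_t:=\begin{bmatrix}0_{n,md}\\ \mathrm{diag}(B_{dt},\dots,B_{d(t+1)-1})\end{bmatrix}$, $\hat C_t:=[\,\mathrm{diag}(C_{dt},\dots,C_{d(t+1)-1})\;\;0_{nd,n}\,]$ (block-diagonal matrices); $\Phi_t:=[0_{n,nd}\;I_n]\hat A_t^{-1}\begin{bmatrix}I_n\\0_{nd,n}\end{bmatrix}$, $\Gamma_t:=[0_{n,nd}\;I_n]\hat A_t^{-1}\hat B_t$, $\Xi_t:=\hat C_t\hat A_t^{-1}\begin{bmatrix}I_n\\0_{nd,n}\end{bmatrix}$, $\Delta_t:=\hat C_t\hat A_t^{-1}\hat B_t$; $\tilde R_t:=\mathrm{diag}(R_{dt},\dots,R_{dt+d-1})+\Delta_t'\Delta_t$, $\tilde Q_t:=\Xi_t'\Xi_t-\Xi_t'\Delta_t\tilde R_t^{-1}\Delta_t'\Xi_t$, $\tilde A_t:=\Phi_t-\Gamma_t\tilde R_t^{-1}\Delta_t'\Xi_t$, $\tilde B_t:=\Gamma_t$. Riccati operator: $\mathcal{R}_t(P):=\tilde Q_t+\tilde A_t'\big(P-P\tilde B_t(\tilde R_t+\tilde B_t'P\tilde B_t)^{-1}\tilde B_t'P\big)\tilde A_t$ for $P\in\mathbb{S}^n_+$. *)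

(* Defs.v *)
From HB Require Import structures.
From mathcomp Require Import all_boot all_order all_algebra.
From mathcomp Require Import boolp classical_sets reals ereal.

Set Implicit Arguments.
Unset Strict Implicit.
Unset Printing Implicit Defensive.

Import Order.TTheory GRing.Theory Num.Theory.
Local Open Scope classical_set_scope.
Local Open Scope ring_scope.

Section MatrixAnalysis.
Variable R : realType.

Definition enorm n (x : 'cV[R]_n) : R := Num.sqrt (\sum_i x i 0 ^+ 2).

(* The set is nonempty and bounded, so this [sup] is a genuine supremum. *)
Definition spnorm m n (M : 'M[R]_(m, n)) : R :=
  sup [set enorm (M *m x) | x in [set x : 'cV[R]_n | enorm x <= 1]].

Definition psdmx n (M : 'M[R]_n) : Prop :=
  M^T = M /\ forall x : 'cV[R]_n, 0 <= (x^T *m M *m x) 0 0.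

Definition pdmx n (M : 'M[R]_n) : Prop :=
  M^T = M /\ forall x : 'cV[R]_n, x != 0 -> 0 < (x^T *m M *m x) 0 0.

Definition loewner_le n (M N : 'M[R]_n) : Prop := psdmx (N - M).

(* For symmetric [M] and [0 < n] the set is finite and nonempty, so this is the
   smallest eigenvalue; it is only used on symmetric matrices. *)
Definition lambda_min n (M : 'M[R]_n) : R := inf [set a | eigenvalue M a].

(* The positive semi-definite square root. It exists and is unique for positive
   semi-definite [M]; the default value 0 is irrelevant in that case. *)
Definition sqrtmx n (M : 'M[R]_n) : 'M[R]_n :=
  xget 0 [set S | psdmx S /\ S *m S = M].

End MatrixAnalysis.

Section ProblemData.
Variables (R : realType) (n m : nat).
Variables (A : nat -> 'M[R]_n) (B : nat -> 'M[R]_(n, m)).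
Variables (Q : nat -> 'M[R]_n) (Rc : nat -> 'M[R]_m).

(* [Theta k d] is the product A_(k+d-1) *m ... *m A_k. *)
Fixpoint Theta (k d : nat) : 'M[R]_n :=
  if d is e.+1 then A (k + e) *m Theta k e else 1%:M.

Definition Cmx (k : nat) : 'M[R]_n := sqrtmx (Q k).

Definition ctrbmx (k d : nat) : 'M[R]_(n, \sum_(i < d) m) :=
  \mxrow_(i < d) (Theta (k + i).+1 (d - i.+1) *m B (k + i)).

(* There are [d + 1] blocks, with indices 0, ..., d. *)
Definition obsvmx (k d : nat) : 'M[R]_(\sum_(i < d.+1) n, n) :=
  \mxcol_(i < d.+1) (Cmx (k + i) *m Theta k i).

Section Lifted.
Variables (d t : nat).

(* Coordinates of R^(n(d+1)) are grouped in d+1 blocks of size n. A block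
   diagonal matrix bordered above by a zero block row therefore occupies the
   positions (j+1, j), and the zero borders need no separate treatment. *)
Definition hatA : 'M[R]_(\sum_(i < d.+1) n) :=
  1%:M - \mxblock_(i < d.+1, j < d.+1)
           (if i == j.+1 :> nat then A (d * t + j) else 0).

Definition hatB : 'M[R]_(\sum_(i < d.+1) n, \sum_(j < d) m) :=
  \mxblock_(i < d.+1, j < d) (if i == j.+1 :> nat then B (d * t + j) else 0).

Definition hatC : 'M[R]_(\sum_(i < d) n, \sum_(j < d.+1) n) :=
  \mxblock_(i < d, j < d.+1) (if i == j :> nat then Cmx (d * t + j) else 0).

(* [0 I_n] *)
Definition lastblk : 'M[R]_(n, \sum_(j < d.+1) n) :=
  \mxrow_(j < d.+1) (if j == d :> nat then 1%:M else 0 : 'M[R]_n).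

(* [I_n; 0] *)
Definition firstblk : 'M[R]_(\sum_(i < d.+1) n, n) :=
  \mxcol_(i < d.+1) (if i == 0%N :> nat then 1%:M else 0 : 'M[R]_n).

Definition Phi : 'M[R]_n := lastblk *m invmx hatA *m firstblk.
Definition Gamma : 'M[R]_(n, \sum_(j < d) m) := lastblk *m invmx hatA *m hatB.
Definition Xi : 'M[R]_(\sum_(i < d) n, n) := hatC *m invmx hatA *m firstblk.
Definition Delta : 'M[R]_(\sum_(i < d) n, \sum_(j < d) m) :=
  hatC *m invmx hatA *m hatB.

Definition tilR : 'M[R]_(\sum_(j < d) m) :=
  \mxdiag_(j < d) Rc (d * t + j) + Delta^T *m Delta.
Definition tilQ : 'M[R]_n :=
  Xi^T *m Xi - Xi^T *m Delta *m invmx tilR *m Delta^T *m Xi.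
Definition tilA : 'M[R]_n := Phi - Gamma *m invmx tilR *m Delta^T *m Xi.
Definition tilB : 'M[R]_(n, \sum_(j < d) m) := Gamma.

Definition riccati (P : 'M[R]_n) : 'M[R]_n :=
  tilQ + tilA^T *m
    (P - P *m tilB *m invmx (tilR + tilB^T *m P *m tilB) *m tilB^T *m P)
    *m tilA.

Definition gain (P : 'M[R]_n) : 'M[R]_(\sum_(j < d) m, n) :=
  invmx (tilR + tilB^T *m P *m tilB) *m tilB^T *m P *m tilA.

End Lifted.
End ProblemData.

(* Main.v *)
(* Completing the square rewrites the Riccati operator at [P] as
   [Q + K^T R K + (A - B K)^T P (A - B K)], with [K] the gain of [P]. Along the
   closed loop this makes [V t := x_t^T (Ric t Xhat_(t+1)) x_t] a Lyapunov
   function: by the Riccati inequality at [t + 1], each step decreases it by at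
   least [lambda_lo |x_t|^2], a fraction [lambda_lo / omega_up] of [V t].
   [Ric t Xhat_(t+1)] is bounded by [Xhat_t] for [t > 0], and [t = 0] is a
   single matrix; the lower bounds are inherited from the lifted [Q]. *)
Require Import Defs.
From HB Require Import structures.
From mathcomp Require Import all_boot all_order all_algebra.
From mathcomp Require Import boolp classical_sets reals ereal.
From mathcomp Require Import ring lra.
Import Order.TTheory GRing.Theory Num.Theory.
Local Open Scope classical_set_scope.
Local Open Scope ring_scope.

Set Implicit Arguments.
Unset Strict Implicit.
Unset Printing Implicit Defensive.

(** On the diagonal this unfolds to the very entry used in [psdmx] and [pdmx], so their positivity
    clauses apply to it directly. Allowing a rectangular [M] lets transposition and products move
    across the two arguments. *)
Definition bform (R : realType) n p (M : 'M[R]_(n, p)) (x : 'cV[R]_n)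
  (y : 'cV[R]_p) : R := (x^T *m M *m y) 0 0.

(** * Bilinear forms, the Euclidean norm and Cauchy-Schwarz *)

Section QuadraticForms.
Variable R : realType.

Lemma bformDl n p (M : 'M[R]_(n, p)) x x' y :
  bform M (x + x') y = bform M x y + bform M x' y.
Proof. by rewrite /bform linearD /= !mulmxDl mxE. Qed.

Lemma bformDr n p (M : 'M[R]_(n, p)) x y y' :
  bform M x (y + y') = bform M x y + bform M x y'.
Proof. by rewrite /bform mulmxDr mxE. Qed.

Lemma bformZl n p (M : 'M[R]_(n, p)) a x y : bform M (a *: x) y = a * bform M x y.
Proof. by rewrite /bform linearZ /= -!scalemxAl mxE. Qed.

Lemma bformZr n p (M : 'M[R]_(n, p)) a x y : bform M x (a *: y) = a * bform M x y.
Proof. by rewrite /bform -scalemxAr mxE. Qed.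

Lemma bform_addmx n p (M N : 'M[R]_(n, p)) x y :
  bform (M + N) x y = bform M x y + bform N x y.
Proof. by rewrite /bform mulmxDr mulmxDl mxE. Qed.

Lemma bform_oppmx n p (M : 'M[R]_(n, p)) x y : bform (- M) x y = - bform M x y.
Proof. by rewrite /bform mulmxN mulNmx mxE. Qed.

Lemma bform_scalar n a (x y : 'cV[R]_n) : bform a%:M x y = a * bform 1%:M x y.
Proof. by rewrite /bform mul_mx_scalar mulmx1 -scalemxAl mxE. Qed.

Lemma bform_tr n p (M : 'M[R]_(n, p)) x y : bform M^T y x = bform M x y.
Proof.
by rewrite /bform -[in RHS](trmxK (x^T *m M *m y)) [in RHS]mxE !trmx_mul trmxK mulmxA.
Qed.

Lemma bform_congr n p (M : 'M[R]_p) (T : 'M[R]_(p, n)) x y :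
  bform (T^T *m M *m T) x y = bform M (T *m x) (T *m y).
Proof. by rewrite /bform trmx_mul !mulmxA. Qed.

Lemma bform_mulmx n p q (M : 'M[R]_(n, p)) (N : 'M[R]_(p, q)) x y :
  bform (M *m N) x y = bform M x (N *m y).
Proof. by rewrite /bform !mulmxA. Qed.

Lemma bform1E n (x : 'cV[R]_n) : bform 1%:M x x = \sum_i x i 0 ^+ 2.
Proof.
by rewrite /bform mulmx1 mxE; apply: eq_bigr => i _; rewrite !mxE expr2.
Qed.

Lemma bform1_ge0 n (x : 'cV[R]_n) : 0 <= bform 1%:M x x.
Proof. by rewrite bform1E; apply: sumr_ge0 => i _; rewrite sqr_ge0. Qed.

Lemma enormE n (x : 'cV[R]_n) : enorm x ^+ 2 = bform 1%:M x x.
Proof. by rewrite /enorm -bform1E sqr_sqrtr ?bform1_ge0. Qed.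

Lemma enorm_ge0 n (x : 'cV[R]_n) : 0 <= enorm x.
Proof. exact: sqrtr_ge0. Qed.

Lemma bform1_eq0 n (x : 'cV[R]_n) : bform 1%:M x x = 0 -> x = 0.
Proof.
rewrite bform1E => /eqP; rewrite psumr_eq0 => [/allP h|i _]; last exact: sqr_ge0.
apply/colP => i; rewrite mxE; apply/eqP.
by have := h i (mem_index_enum i); rewrite /= sqrf_eq0.
Qed.

Lemma bform1_gt0 n (x : 'cV[R]_n) : x != 0 -> 0 < bform 1%:M x x.
Proof.
by move=> x0; rewrite lt_def bform1_ge0 andbT; apply: contraNneq x0 => /bform1_eq0 ->.
Qed.

Lemma psdmx1 n : psdmx (1%:M : 'M[R]_n).
Proof. by split=> [|x]; [rewrite trmx1 | exact: bform1_ge0]. Qed.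

Lemma pdmx_psd n (M : 'M[R]_n) : pdmx M -> psdmx M.
Proof.
move=> [Msym Mpos]; split=> // x; have [->|/Mpos/ltW//] := eqVneq x 0.
by rewrite mulmx0 mxE.
Qed.

Lemma psd_cauchy_schwarz n (M : 'M[R]_n) x y : psdmx M ->
  bform M x y ^+ 2 <= bform M x x * bform M y y.
Proof.
move=> [Msym Mpos].
have h s t : 0 <= s ^+ 2 * bform M x x + 2 * s * t * bform M x y
                   + t ^+ 2 * bform M y y.
  have -> : s ^+ 2 * bform M x x + 2 * s * t * bform M x y + t ^+ 2 * bform M y y
          = bform M (s *: x + t *: y) (s *: x + t *: y).
    rewrite !(bformDl, bformDr, bformZl, bformZr).
    by rewrite -(bform_tr M y x) Msym; ring.
  exact: Mpos.
have a0 : 0 <= bform M x x := Mpos x; have c0 : 0 <= bform M y y := Mpos y.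
move: (bform M x y) (bform M x x) (bform M y y) a0 c0 h => b a c a0 c0 h.
(* The coefficients minimise the quadratic in one variable without dividing, so that [a] or [c] may
   vanish. If both vanish, [h 1 (- b)] reads [0 <= - 2 * b ^+ 2] and forces [b = 0]. *)
have h1 : 0 <= c * (a * c - b ^+ 2) by have := h c (- b); lra.
have h2 : 0 <= a * (a * c - b ^+ 2) by have := h (- b) a; lra.
move: c0; rewrite le_eqVlt => /orP[/eqP c0|c0]; last by rewrite -subr_ge0 -(pmulr_rge0 _ c0).
move: a0; rewrite le_eqVlt => /orP[/eqP a0|a0]; last by rewrite -subr_ge0 -(pmulr_rge0 _ a0).
by have := h 1 (- b); rewrite -a0 -c0; nra.
Qed.

(** Cauchy-Schwarz on each row; the constant is the squared Frobenius norm. *)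
Lemma mulmx_bounded m n (M : 'M[R]_(m, n)) :
  exists2 C, 0 <= C & forall x, enorm (M *m x) ^+ 2 <= C * enorm x ^+ 2.
Proof.
exists (\sum_i enorm (row i M)^T ^+ 2).
  by apply: sumr_ge0 => i _; exact: sqr_ge0.
move=> x; rewrite [X in X <= _]enormE bform1E mulr_suml; apply: ler_sum => i _.
have -> : (M *m x) i 0 = bform 1%:M (row i M)^T x.
  by rewrite /bform mulmx1 trmxK -row_mul [RHS]mxE.
by rewrite !enormE; apply: psd_cauchy_schwarz; exact: psdmx1.
Qed.

(** * The spectral norm *)

Lemma enormZ n a (x : 'cV[R]_n) : 0 <= a -> enorm (a *: x) = a * enorm x.
Proof.
move=> a0; apply/eqP; rewrite -(eqrXn2 (n := 2)) ?mulr_ge0 ?enorm_ge0//.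
by rewrite exprMn !enormE bformZl bformZr mulrA.
Qed.

Lemma enorm_mulmx_le m n (M : 'M[R]_(m, n)) x :
  enorm (M *m x) <= spnorm M * enorm x.
Proof.
have [C C0 hC] := mulmx_bounded M.
(* The [sup] in [spnorm] dominates its set only once the set is known to be bounded. A nonzero [x]
   is then rescaled to norm 1. *)
have ub : has_ubound [set enorm (M *m x) | x in [set x : 'cV[R]_n | enorm x <= 1]].
  exists (Num.sqrt C) => _ [y /= y1 <-].
  rewrite -(ger0_norm (enorm_ge0 (M *m y))) -sqrtr_sqr ler_wsqrtr//.
  by apply: le_trans (hC y) _; rewrite -[leRHS]mulr1 ler_wpM2l// expr_le1 ?enorm_ge0.
have [->|x0] := eqVneq x 0.
  by rewrite mulmx0 -(scale0r (0 : 'cV[R]_m)) -(scale0r (0 : 'cV[R]_n)) !enormZ// !mul0r mulr0.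
have xgt0 : 0 < enorm x.
  by rewrite -(ltr_pXn2r (n := 2)) ?nnegrE ?enorm_ge0// enormE expr0n bform1_gt0.
rewrite -ler_pdivrMr// mulrC -enormZ ?invr_ge0 ?enorm_ge0// scalemxAr.
apply: ub_le_sup => //; exists ((enorm x)^-1 *: x) => //=.
by rewrite enormZ ?invr_ge0 ?enorm_ge0// mulVf ?gt_eqF.
Qed.

Lemma spnorm_le m n (M : 'M[R]_(m, n)) C : 0 <= C ->
  (forall x, enorm (M *m x) <= C * enorm x) -> spnorm M <= C.
Proof.
move=> C0 h; apply: ge_sup.
  exists (enorm (M *m 0)); exists 0 => //=.
  by rewrite -(scale0r (0 : 'cV[R]_n)) enormZ// mul0r.
move=> _ [x /= x1 <-]; apply: le_trans (h x) _.
by rewrite -[leRHS]mulr1 ler_wpM2l.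
Qed.

Lemma bform_le_spnorm n (M : 'M[R]_n) x :
  `|bform M x x| <= spnorm M * bform 1%:M x x.
Proof.
have x0 := enorm_ge0 x; have Mx := enorm_mulmx_le M x.
have Mx0 := enorm_ge0 (M *m x).
have -> : bform M x x = bform 1%:M x (M *m x) by rewrite -bform_mulmx mul1mx.
apply: (@le_trans _ _ (enorm x * enorm (M *m x))); last first.
  by rewrite -enormE expr2 mulrA [leRHS]mulrC ler_wpM2l.
rewrite -(ler_pXn2r (n := 2)) ?nnegrE ?mulr_ge0// real_normK ?num_real//.
by rewrite exprMn !enormE psd_cauchy_schwarz//; exact: psdmx1.
Qed.

(* This is Cauchy-Schwarz for the form [M] itself, at [x] and [M *m x]. *)
Lemma psd_enorm_mulmx n (M : 'M[R]_n) C x : 0 <= C -> psdmx M ->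
  (forall y, bform M y y <= C * bform 1%:M y y) ->
  enorm (M *m x) ^+ 2 <= C * bform M x x.
Proof.
move=> C0 Mpsd hC.
have := psd_cauchy_schwarz x (M *m x) Mpsd.
have -> : bform M x (M *m x) = enorm (M *m x) ^+ 2.
  by rewrite enormE -bform_congr Mpsd.1 mulmx1 bform_mulmx.
have a0 : 0 <= bform M x x := Mpsd.2 x.
(* Cauchy-Schwarz bounds the square of [enorm (M *m x) ^+ 2]; one factor is cancelled, which needs
   it to be positive. *)
have [z0|z0] := leP (enorm (M *m x) ^+ 2) 0.
  by move=> _; apply: le_trans z0 _; rewrite mulr_ge0.
move=> h; rewrite -(ler_pM2r z0) -expr2; apply: le_trans h _.
by rewrite [C * _]mulrC -mulrA ler_wpM2l// enormE hC.
Qed.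

(** Turns a Loewner bound into a norm bound, through [|M x|^2 <= C x^T M x <= C^2 |x|^2]. *)
Lemma psd_spnorm_le n (M : 'M[R]_n) C : 0 <= C -> psdmx M ->
  (forall y, bform M y y <= C * bform 1%:M y y) -> spnorm M <= C.
Proof.
move=> C0 Mpsd hC; apply: spnorm_le => // x.
rewrite -(ler_pXn2r (n := 2)) ?nnegrE ?mulr_ge0 ?enorm_ge0//.
apply: le_trans (psd_enorm_mulmx x C0 Mpsd hC) _.
by rewrite exprMn expr2 -mulrA ler_wpM2l// enormE.
Qed.

(** * Invertibility of definite matrices and the smallest eigenvalue *)

Lemma pdmx_unit n (M : 'M[R]_n) : pdmx M -> M \in unitmx.
Proof.
move=> [_ Mpos]; rewrite -row_free_unit; apply: inj_row_free => v vM0.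
apply/eqP/negPn/negP => v0; have := Mpos v^T.
rewrite -(inj_eq trmx_inj) trmx0 in v0 *.
by rewrite trmxK vM0 mul0mx mxE ltxx => /(_ v0).
Qed.

(* The largest [a] with [a |x|^2 <= x^T M x] is an eigenvalue: were [M - a%:M]
   invertible, it would be bounded below by a positive multiple of the identity. *)
Lemma lambda_min_spec n (M : 'M[R]_n) : (0 < n)%N -> M^T = M ->
  eigenvalue M (lambda_min M) /\
  forall x, lambda_min M * bform 1%:M x x <= bform M x x.
Proof.
move=> n0 Msym.
pose L := [set a | forall x, a * bform 1%:M x x <= bform M x x].
have L0 : L !=set0.
  exists (- spnorm M) => x; have := bform_le_spnorm M x.
  by rewrite ler_norml mulNr => /andP[].
have Lub x a : x != 0 -> L a -> a <= bform M x x / bform 1%:M x x.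
  by move=> x0 La; rewrite ler_pdivlMr ?bform1_gt0.
(* Any nonzero vector would do: its Rayleigh quotient bounds [L] from above. It exists because
   [0 < n]. *)
pose e : 'cV[R]_n := const_mx 1.
have e0 : e != 0.
  apply/eqP => /matrixP/(_ (Ordinal n0) 0); rewrite !mxE => /eqP.
  by rewrite oner_eq0.
have Lbd : has_ubound L by exists (bform M e e / bform 1%:M e e) => a; exact: Lub.
pose a := sup L.
have La : L a.
  move=> x; have [->|x0] := eqVneq x 0.
    by rewrite /bform !mulmx0 !mxE mulr0.
  by rewrite -ler_pdivlMr ?bform1_gt0//; apply: ge_sup => // b; exact: Lub.
pose N := M - a%:M.
have NE x y : bform N x y = bform M x y - a * bform 1%:M x y.
  by rewrite /N bform_addmx bform_oppmx bform_scalar.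
have Npsd : psdmx N.
  split; first by rewrite linearB /= Msym tr_scalar_mx.
  by move=> x; rewrite -/(bform N x x) NE subr_ge0; exact: La.
have eig : eigenvalue M a.
  rewrite /eigenvalue /eigenspace kermx_eq0 row_free_unit; apply/negP => Nu.
  pose C := spnorm N + 1.
  have sN0 : 0 <= spnorm N.
    have := le_trans (normr_ge0 _) (bform_le_spnorm N e).
    by rewrite pmulr_lge0 ?bform1_gt0.
  have hC y : bform N y y <= C * bform 1%:M y y.
    have := le_trans (ler_norm _) (bform_le_spnorm N y).
    have := bform1_ge0 y; rewrite /C; nra.
  have [D D0 hD] := mulmx_bounded (invmx N).
  have C0 : 0 < C by rewrite /C; lra.
  (* Chaining [|x|^2 <= D |N x|^2] with [|N x|^2 <= C x^T N x] gives [c |x|^2 <= x^T N x], so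
     [a + c] lies in [L], above its supremum. The added ones keep both constants positive. *)
  pose c := ((D + 1) * C)^-1.
  have c0 : 0 < c by rewrite invr_gt0 mulr_gt0//; lra.
  have : L (a + c).
    move=> x; rewrite mulrDl -lerBrDl -NE /c ler_pdivrMl; last by rewrite mulr_gt0//; lra.
    have := hD (N *m x); rewrite mulKmx// -enormE => h1.
    have := psd_enorm_mulmx x (ltW C0) Npsd hC => h2.
    have := sqr_ge0 (enorm (N *m x)) => h3.
    apply: (le_trans h1); rewrite -mulrA.
    apply: (@le_trans _ _ ((D + 1) * enorm (N *m x) ^+ 2)); first by nra.
    by rewrite ler_wpM2l//; lra.
  by move/(ub_le_sup Lbd); rewrite -/a; lra.
have lb b : eigenvalue M b -> a <= b.
  move=> /eigenvalueP[v vM v0]; have := La v^T.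
  have -> : bform M v^T v^T = b * bform 1%:M v^T v^T.
    by rewrite /bform trmxK vM mulmx1 -scalemxAl mxE.
  rewrite ler_pM2r// bform1_gt0//.
  by rewrite -(inj_eq trmx_inj) trmxK trmx0.
suff -> : lambda_min M = a by [].
apply/eqP; rewrite eq_le; apply/andP; split.
  by apply: ge_inf => //; exists a => b; exact: lb.
by apply: lb_le_inf; [exists a | move=> b; exact: lb].
Qed.

(** Since [lambda_min M] is an actual eigenvalue, it suffices to test the hypothesis at an
    eigenvector. *)
Lemma lambda_min_ge n (M : 'M[R]_n) a : (0 < n)%N -> M^T = M ->
  (forall x, a * bform 1%:M x x <= bform M x x) -> a <= lambda_min M.
Proof.
move=> n0 Msym h; have [/eigenvalueP[v vM v0] _] := lambda_min_spec n0 Msym.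
have := h v^T.
have -> : bform M v^T v^T = lambda_min M * bform 1%:M v^T v^T.
  by rewrite /bform trmxK vM mulmx1 -scalemxAl mxE.
by rewrite ler_pM2r// bform1_gt0// -(inj_eq trmx_inj) trmxK trmx0.
Qed.

Lemma lambda_min_le_spnorm n (M : 'M[R]_n) : (0 < n)%N -> M^T = M ->
  lambda_min M <= spnorm M.
Proof.
move=> n0 Msym; have [/eigenvalueP[v vM v0] h] := lambda_min_spec n0 Msym.
have v0' : v^T != 0 by rewrite -(inj_eq trmx_inj) trmxK trmx0.
have := le_trans (h v^T) (le_trans (ler_norm _) (bform_le_spnorm M v^T)).
by rewrite ler_pM2r// bform1_gt0.
Qed.

(** * Stability of definiteness under sums, congruence and block diagonals *)

Lemma psdmx_add n (M N : 'M[R]_n) : psdmx M -> psdmx N -> psdmx (M + N).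
Proof.
move=> [Ms Mp] [Ns Np]; split=> [|x]; first by rewrite linearD /= Ms Ns.
by rewrite -/(bform _ x x) bform_addmx addr_ge0//; [exact: Mp | exact: Np].
Qed.

Lemma pdmx_add n (M N : 'M[R]_n) : pdmx M -> psdmx N -> pdmx (M + N).
Proof.
move=> [Ms Mp] [Ns Np]; split=> [|x x0]; first by rewrite linearD /= Ms Ns.
rewrite -/(bform _ x x) bform_addmx ltr_wpDr//; [exact: Np | exact: Mp].
Qed.

Lemma psdmx_congr n p (M : 'M[R]_p) (T : 'M[R]_(p, n)) :
  psdmx M -> psdmx (T^T *m M *m T).
Proof.
move=> [Ms Mp]; split=> [|x]; first by rewrite !trmx_mul trmxK Ms mulmxA.
by rewrite -/(bform _ x x) bform_congr; exact: Mp.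
Qed.

Lemma pdmx_mxdiag p m (D : 'I_p -> 'M[R]_m) :
  (forall i, pdmx (D i)) -> pdmx (\mxdiag_(i < p) D i).
Proof.
move=> Dpd; split=> [|x x0].
  by rewrite tr_mxdiag; apply: eq_mxdiag => i; have [] := Dpd i.
rewrite -(submxcolK x) tr_mxcol -mulmxA mul_mxdiag_mxcol mul_mxrow_mxcol.
rewrite summxE.
have D0 i : 0 <= ((submxcol x i)^T *m (D i *m submxcol x i)) 0 0.
  by rewrite mulmxA; exact: (pdmx_psd (Dpd i)).2.
rewrite lt_def sumr_ge0 ?andbT//.
apply: contraNneq x0 => s0; apply/eqP; rewrite -(submxcolK x).
rewrite -[RHS]mxcol0; apply/eq_mxcolP => i; apply/eqP; apply/negPn/negP => xi0.
have /eqP := s0; rewrite psumr_eq0// => /allP/(_ i (mem_index_enum i)).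
by rewrite /= mulmxA gt_eqF//; exact: (Dpd i).2.
Qed.

End QuadraticForms.

(** With [W = T + B^T P B] and [N = B^T P A], the gain solves [W K = N]. Every cross term then
    becomes [N^T K], and both sides reduce to [S + A^T P A - N^T K]. *)
Lemma completion_of_squares (R : realType) n p (A : 'M[R]_n) (B : 'M[R]_(n, p))
    (S P : 'M[R]_n) (T : 'M[R]_p) (K : 'M[R]_(p, n)) :
  P^T = P -> pdmx T -> psdmx P ->
  K = invmx (T + B^T *m P *m B) *m B^T *m P *m A ->
  S + A^T *m (P - P *m B *m invmx (T + B^T *m P *m B) *m B^T *m P) *m A =
  S + K^T *m T *m K + (A - B *m K)^T *m P *m (A - B *m K).
Proof.
move=> Psym Tpd Ppsd; set W := T + _ => KE.
have Wpd : pdmx W by apply: pdmx_add => //; exact: psdmx_congr.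
pose N := B^T *m P *m A.
have WK : W *m K = N by rewrite KE -!mulmxA mulKVmx ?pdmx_unit// /N !mulmxA.
have KW : K^T *m W = N^T by rewrite -WK trmx_mul Wpd.1.
have NE : A^T *m P *m B = N^T by rewrite /N !trmx_mul trmxK Psym !mulmxA.
rewrite -addrA; congr (_ + _).
have -> : K^T *m T *m K = N^T *m K - K^T *m (B^T *m P *m B) *m K.
  by rewrite -KW -mulmxBl -mulmxBr /W addrK.
have -> : (A - B *m K)^T = A^T - K^T *m B^T by rewrite linearB /= trmx_mul.
rewrite !(mulmxBl, mulmxBr) !mulmxA NE.
have -> : K^T *m B^T *m P *m A = N^T *m K.
  by rewrite -KW -[RHS]mulmxA WK /N !mulmxA.
have -> : N^T *m invmx W *m B^T *m P *m A = N^T *m K by rewrite KE !mulmxA.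
by rewrite [RHS]addrC subrK.
Qed.

(** * The completed square for the lifted data *)

Section LiftedData.
Variables (R : realType) (n m : nat) (A : nat -> 'M[R]_n) (B : nat -> 'M[R]_(n, m)).
Variables (Q : nat -> 'M[R]_n) (Rc : nat -> 'M[R]_m) (d t : nat).
Hypothesis Rc_pd : forall k, pdmx (Rc k).

Let T := tilR A B Q Rc d t.
Let At := tilA A B Q Rc d t.
Let Bt := tilB A B d t.

Lemma pdmx_tilR : pdmx T.
Proof.
apply: pdmx_add; first by apply: pdmx_mxdiag => i; exact: Rc_pd.
by have := psdmx_congr (Delta A B Q d t) (psdmx1 R _); rewrite mulmx1.
Qed.

Lemma tr_tilQ : (tilQ A B Q Rc d t)^T = tilQ A B Q Rc d t.
Proof.
have [Tsym _] := pdmx_tilR; rewrite /tilQ -/T.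
move: (Xi A Q d t) (Delta A B Q d t) => X D.
by rewrite linearB /= !trmx_mul !trmxK trmx_inv Tsym !mulmxA.
Qed.

Lemma riccatiE P : psdmx P ->
  riccati A B Q Rc d t P =
  tilQ A B Q Rc d t
  + (gain A B Q Rc d t P)^T *m T *m gain A B Q Rc d t P
  + (At - Bt *m gain A B Q Rc d t P)^T *m P *m (At - Bt *m gain A B Q Rc d t P).
Proof.
by move=> Ppsd; apply: completion_of_squares => //; [case: Ppsd | exact: pdmx_tilR].
Qed.

End LiftedData.

(** * Finite suprema and infima of real sequences *)

Lemma ereal_sup_range_fin (R : realType) (f : nat -> R) M :
  (forall t, f t <= M) ->
  exists o, ereal_sup (range (fun t => (f t)%:E)) = o%:E /\ forall t, f t <= o.
Proof.
move=> fM; set s := ereal_sup _.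
have ub t : ((f t)%:E <= s)%E by apply: ereal_sup_ubound; exists t.
have : (s <= M%:E)%E by apply: ge_ereal_sup => _ [t _ <-]; rewrite lee_fin.
by case: s ub (ub 0%N) => [o| |]// ub _ _; exists o; split=> // t; rewrite -lee_fin.
Qed.

(** The bound [c] is an extended real so that the infimum itself, known only to be positive, can
    serve as its own lower bound. *)
Lemma ereal_inf_range_fin (R : realType) (f : nat -> R) (c : \bar R) :
  (-oo < c)%E -> (forall t, (c <= (f t)%:E)%E) ->
  exists o, [/\ ereal_inf (range (fun t => (f t)%:E)) = o%:E, (c <= o%:E)%E
    & forall t, o <= f t].
Proof.
move=> c0 cf; set s := ereal_inf _.
have lb t : (s <= (f t)%:E)%E by apply: ereal_inf_lbound; exists t.
have : (c <= s)%E by apply: le_ereal_inf_tmp => _ [t _ <-].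
case: s lb (lb 0%N) => [o| |]// lb _ cs.
- by exists o; split=> // t; rewrite -lee_fin.
- by have := lt_le_trans c0 cs.
Qed.

(** * Exponential decay of the closed loop *)

Theorem theorem2 (R : realType) (n m d : nat)
  (A : nat -> 'M[R]_n) (B : nat -> 'M[R]_(n, m))
  (Q : nat -> 'M[R]_n) (Rc : nat -> 'M[R]_m)
  (Xhat : nat -> 'M[R]_n) :
  let At := tilA A B Q Rc d in
  let Bt := tilB A B d in
  let Qt := tilQ A B Q Rc d in
  let Rt := tilR A B Q Rc d in
  let Ric := riccati A B Q Rc d in
  let K := fun t => gain A B Q Rc d t (Xhat t.+1) in
  let omega_up := ereal_sup (range (fun t => (spnorm (Ric t (Xhat t.+1)))%:E)) in
  let omega_lo :=
    ereal_inf (range (fun t => (lambda_min (Ric t (Xhat t.+1)))%:E)) in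
  let lambda_lo :=
    ereal_inf
      (range (fun t => (lambda_min (Qt t + (K t)^T *m Rt t *m K t))%:E)) in
  (0 < n)%N -> (0 < m)%N -> (0 < d)%N ->
  (forall k, psdmx (Q k)) ->
  (forall k, pdmx (Rc k)) ->
  (exists M : R, forall k, spnorm (A k) <= M) ->
  (exists M : R, forall k, spnorm (B k) <= M) ->
  (exists M : R, forall k, spnorm (Q k) <= M) ->
  (exists M : R, forall k, spnorm (Rc k) <= M) ->
  (forall k, A k \in unitmx) ->
  (forall k, \rank (ctrbmx A B k d) = n) ->
  (forall k, \rank (obsvmx A Q k d) = n) ->
  (0 < ereal_inf (range (fun t => (lambda_min (Qt t))%:E)))%E ->
  (0 < ereal_inf (range (fun t => (lambda_min (Bt t *m (Bt t)^T))%:E)))%E ->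
  (0 < ereal_inf (range (fun t => (lambda_min (At t *m (At t)^T))%:E)))%E ->
  (forall t, pdmx (Xhat t.+1)) ->
  (exists M : R, forall t, spnorm (Xhat t.+1) <= M) ->
  (forall t, (0 < t)%N -> loewner_le (Ric t (Xhat t.+1)) (Xhat t)) ->
  [/\ (omega_up < +oo)%E,
      (0 < omega_lo)%E,
      (0 < lambda_lo <= omega_up)%E &
      forall (x : nat -> 'cV[R]_n) (u : nat -> 'cV[R]_(\sum_(j < d) m)),
        (forall t, x t.+1 = At t *m x t + Bt t *m u t) ->
        (forall t, u t = - (K t *m x t)) ->
        forall t, enorm (x t) ^+ 2 <=
          fine omega_up / fine omega_lo
            * (1 - fine lambda_lo / fine omega_up) ^+ t * enorm (x 0%N) ^+ 2].
Proof.
move=> At Bt Qt Rt Ric K omega_up omega_lo lambda_lo n_gt0 _ _ _ Rc_pd.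
move=> _ _ _ _ _ _ _ Q_inf _ _ X_pd [M X_le] X_ric.
(* [W] is the Lyapunov matrix, [L] the stage cost under the policy, and [F] the closed-loop
   transition matrix. *)
pose W t := Ric t (Xhat t.+1).
pose L t := Qt t + (K t)^T *m Rt t *m K t.
pose F t := At t - Bt t *m K t.
have WE t : W t = L t + (F t)^T *m Xhat t.+1 *m F t.
  exact: riccatiE (pdmx_psd (X_pd t)).
(* The real [q] bounds every lifted [Q] from below, hence also [L] and [W], which only add positive
   semi-definite terms. *)
have [q [qE q_pos q_le]] := ereal_inf_range_fin (lt_trans ltNy0 Q_inf)
  (fun t => ereal_inf_lbound (ex_intro2 _ _ t I erefl)).
rewrite qE lte_fin in Q_inf.
have Q_ge t x : q * bform 1%:M x x <= bform (Qt t) x x.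
  have [_ h] := lambda_min_spec n_gt0 (tr_tilQ A B Q d t Rc_pd).
  by apply: le_trans (h x); rewrite ler_wpM2r ?bform1_ge0 ?q_le.
have KRK_psd t : psdmx ((K t)^T *m Rt t *m K t).
  by apply: psdmx_congr; apply: pdmx_psd; exact: pdmx_tilR.
have L_sym t : (L t)^T = L t.
  by rewrite linearD /= (KRK_psd t).1 tr_tilQ.
have L_ge t x : q * bform 1%:M x x <= bform (L t) x x.
  by rewrite bform_addmx; apply: le_trans (Q_ge t x) _; rewrite lerDl; exact: (KRK_psd t).2.
have FXF_psd t : psdmx ((F t)^T *m Xhat t.+1 *m F t).
  by apply: psdmx_congr; exact: pdmx_psd.
have W_psd t : psdmx (W t).
  rewrite WE; apply: psdmx_add => //; split=> // x.
  by apply: le_trans (L_ge t x); rewrite mulr_ge0 ?bform1_ge0// ltW.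
have L_leW t x : bform (L t) x x <= bform (W t) x x.
  by rewrite WE bform_addmx lerDl; exact: (FXF_psd t).2.
have M0 : 0 <= M.
  have := le_trans (lambda_min_le_spnorm n_gt0 (X_pd 0%N).1) (X_le 0%N).
  apply: le_trans; apply: lambda_min_ge => // [|x]; first exact: (X_pd 0%N).1.
  by rewrite mul0r; exact: (pdmx_psd (X_pd 0%N)).2.
(* The Riccati inequality is assumed for positive times only, hence the shifted index; [W 0] enters
   the bound [W_ub] separately. *)
have W_leX t x : bform (W t.+1) x x <= bform (Xhat t.+1) x x.
  by have [_ /(_ x)] := X_ric t.+1 isT; rewrite -/(bform _ x x) bform_addmx bform_oppmx subr_ge0.
have W_le t : spnorm (W t.+1) <= M.
  apply: psd_spnorm_le => // x; apply: le_trans (W_leX t x) _.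
  apply: le_trans (ler_norm _) _; apply: le_trans (bform_le_spnorm _ _) _.
  by rewrite ler_wpM2r ?bform1_ge0.
have W_ub t : spnorm (W t) <= Num.max (spnorm (W 0%N)) M.
  rewrite le_max; apply/orP; case: t => [|t]; first by left.
  by right; exact: W_le.
have [wu [wuE wu_ge]] := ereal_sup_range_fin W_ub.
have wlo_q t : (q%:E <= (lambda_min (W t))%:E)%E.
  rewrite lee_fin; apply: lambda_min_ge => // [|x]; first exact: (W_psd t).1.
  exact: le_trans (L_ge t x) (L_leW t x).
have [wl [wlE q_wl wl_le]] := ereal_inf_range_fin (ltNyr q) wlo_q.
have ll_q t : (q%:E <= (lambda_min (L t))%:E)%E.
  by rewrite lee_fin; exact: lambda_min_ge.
have [ll [llE q_ll ll_le]] := ereal_inf_range_fin (ltNyr q) ll_q.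
rewrite !lee_fin in q_wl q_ll.
have wl_pos : 0 < wl := lt_le_trans Q_inf q_wl.
have ll_pos : 0 < ll := lt_le_trans Q_inf q_ll.
have ll_L t x : ll * bform 1%:M x x <= bform (L t) x x.
  apply: le_trans ((lambda_min_spec n_gt0 (L_sym t)).2 x).
  by rewrite ler_wpM2r ?bform1_ge0.
have W_wu t x : bform (W t) x x <= wu * bform 1%:M x x.
  apply: le_trans (ler_norm _) _; apply: le_trans (bform_le_spnorm _ _) _.
  by rewrite ler_wpM2r ?bform1_ge0.
have wl_W t x : wl * bform 1%:M x x <= bform (W t) x x.
  apply: le_trans ((lambda_min_spec n_gt0 (W_psd t).1).2 x).
  by rewrite ler_wpM2r ?bform1_ge0.
(* Already visible at time 0, where [ll] bounds [L 0], which lies below [W 0]. It makes the rate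
   [rho] nonnegative, as iterating [step] requires. *)
have ll_wu : ll <= wu.
  apply: le_trans (wu_ge 0%N); apply: le_trans (lambda_min_le_spnorm n_gt0 (W_psd 0%N).1).
  apply: lambda_min_ge => // [|x]; first exact: (W_psd 0%N).1.
  exact: le_trans (ll_L 0%N x) (L_leW 0%N x).
have wu_pos : 0 < wu := lt_le_trans ll_pos ll_wu.
rewrite /omega_up /omega_lo /lambda_lo wuE wlE llE !lte_fin lee_fin ltry /=.
split=> //; first by rewrite ll_pos.
move=> x u xE uE t; set rho := 1 - ll / wu.
have rho0 : 0 <= rho by rewrite subr_ge0 ler_pdivrMr// mul1r.
have xF s : x s.+1 = F s *m x s.
  by rewrite xE uE mulmxN mulmxA -mulmxBl.
have step s : bform (W s.+1) (x s.+1) (x s.+1) <= rho * bform (W s) (x s) (x s).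
  apply: le_trans (W_leX s _) _.
  have -> : bform (Xhat s.+1) (x s.+1) (x s.+1)
          = bform (W s) (x s) (x s) - bform (L s) (x s) (x s).
    by rewrite WE bform_addmx bform_congr -xF addrC addKr.
  (* What remains is [ll / wu * x^T W x <= ll |x|^2], which is the upper bound [W_wu] rescaled. *)
  rewrite mulrBl mul1r lerD2l lerN2; apply: le_trans (ll_L s _).
  by rewrite mulrAC ler_pdivrMr// -mulrA ler_pM2l// mulrC W_wu.
have decay s : bform (W s) (x s) (x s) <= rho ^+ s * bform (W 0%N) (x 0%N) (x 0%N).
  elim: s => [|s IH]; first by rewrite expr0 mul1r.
  by apply: le_trans (step s) _; rewrite exprS -mulrA ler_wpM2l.
(* Multiplying by [wl] sets up the chain [wl |x_t|^2 <= V t <= rho^t V 0 <= rho^t wu |x_0|^2], with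
   [V t = x_t^T (W t) x_t]. *)
rewrite !enormE -(ler_pM2l wl_pos).
apply: le_trans (wl_W t _) _; apply: le_trans (decay t) _.
have -> : forall e, wl * (wu / wl * rho ^+ t * e) = rho ^+ t * (wu * e).
  by move=> e; field; rewrite gt_eqF.
by rewrite ler_wpM2l ?exprn_ge0.
Qed.
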